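(* Let $q\equiv 3\pmod 4$ be a prime with $3<q<200$, and let $p\equiv 3\pmod 4$ be a prime with $p>3$ and $(p-1)\mid(q-1)$. Then there exists a PS$(pq)$, equivalently a ZCPS-Wh$(pq)$.
   Context: For an abelian group $(G,+)$ of order $v\equiv 1\pmod 4$, a partitionable set PS$(G)$ is a set $\mathcal S$ of $(v-1)/4$ unordered pairs $\{x,y\}$ from $G$ such that $\bigcup_{\{x,y\}\in\mathcal S}\pm\{x,y\}=G\setminus\{0\}$ and $\bigcup_{\{x,y\}\in\mathcal S}\pm\{x-y,x+y\}=G\setminus\{0\}$; for $G=\mathbb{Z}_v$ it is written PS$(v)$. A ZCPS-Wh$(v)$ ($\mathbb{Z}$-cyclic patterned starter whist tournament) for $v\equiv1\pmod4$ is a whist tournament on player set $\mathbb{Z}_v$ (games $(a,b,c,d)$ with partner pairs $\{a,c\},\{b,d\}$ and opponent pairs $\{a,b\},\{c,d\},\{a,d\},\{b,c\}$, arranged in $v$ rounds of $(v-1)/4$ games, each player playing in all rounds but one, each player partnering every other exactly once and opposing every other exactly twice) in which round $j+1$ is obtained from round $j$ by adding $1$ to each player, $0$ is missing from the initial round, and the partner pairs of the initial round are exactly $\{\{x,-x\}:x\in\mathbb{Z}_v\setminus\{0\}\}$. *)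

(* Defs.v *)
From mathcomp Require Import all_boot all_order all_algebra.

Set Implicit Arguments.
Unset Strict Implicit.
Unset Printing Implicit Defensive.

Import GRing.Theory.
Local Open Scope ring_scope.

Section PartitionableSets.

Variable G : finZmodType.

Definition pm (A : {set G}) : {set G} := A :|: [set - x | x in A].

(* Unordered pairs are two-element sets; the unions range over all orderings
   (x, y) of the pairs, which is harmless because both sets pm _ are symmetric
   in x and y. *)
Definition partitionable_set (S : {set {set G}}) : Prop :=
  [/\ (#|G| = 1 %[mod 4])%N,
      #|S| = ((#|G| - 1) %/ 4)%N,
      (forall P : {set G}, P \in S -> #|P| = 2%N),
      \bigcup_(u : G * G | [set u.1; u.2] \in S) pm [set u.1; u.2] = [set~ 0]
    & \bigcup_(u : G * G | [set u.1; u.2] \in S) pm [set u.1 - u.2; u.1 + u.2]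
      = [set~ 0]].

End PartitionableSets.

Section Whist.

Local Open Scope nat_scope.

Variable T : finType.

Definition game : Type := (T * T * T * T)%type.

Definition players (g : game) : {set T} :=
  let: (a, b, c, d) := g in [set a; b; c; d].

Definition partner_pairs (g : game) : {set {set T}} :=
  let: (a, b, c, d) := g in [set [set a; c]; [set b; d]].

Definition opponent_pairs (g : game) : {set {set T}} :=
  let: (a, b, c, d) := g in
  [set [set a; b]; [set c; d]; [set a; d]; [set b; c]].

Definition round : Type := {set game}.

Record whist_tournament (v : nat) (R : 'I_v -> round) : Prop := {
  wh_card : #|T| = v;
  wh_mod4 : v = 1 %[mod 4];
  wh_distinct : forall (j : 'I_v) (g : game), g \in R j -> #|players g| = 4;
  wh_round_size : forall j : 'I_v, #|R j| = (v - 1) %/ 4;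
  wh_round_disjoint : forall (j : 'I_v) (x : T),
    #|[set g in R j | x \in players g]| <= 1;
  wh_one_bye : forall x : T,
    #|[set j : 'I_v | [forall g in R j, x \notin players g]]| = 1;
  wh_partner_once : forall x y : T, x != y ->
    #|[set u : 'I_v * game |
        (u.2 \in R u.1) && ([set x; y] \in partner_pairs u.2)]| = 1;
  wh_oppose_twice : forall x y : T, x != y ->
    #|[set u : 'I_v * game |
        (u.2 \in R u.1) && ([set x; y] \in opponent_pairs u.2)]| = 2
}.

End Whist.

Definition shift_game (G : finZmodType) (t : G) (g : game G) : game G :=
  let: (a, b, c, d) := g in (a + t, b + t, c + t, d + t).

(* wh_card forces #|'Z_v| = v, which excludes the degenerate 'Z_0 and 'Z_1. *)
Record ZCPS_whist (v : nat) (R : 'I_v -> round 'Z_v) : Prop := {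
  zcps_whist : whist_tournament R;
  zcps_cyclic : forall i j : 'I_v, j = i.+1 :> nat ->
    R j = [set shift_game 1 g | g in R i];
  zcps_bye0 : forall i : 'I_v, i = 0%N :> nat ->
    forall g : game 'Z_v, g \in R i -> 0 \notin players g;
  zcps_starter : forall i : 'I_v, i = 0%N :> nat ->
    \bigcup_(g in R i) partner_pairs g
    = [set [set x; - x] | x in [set~ (0 : 'Z_v)]]
}.

(* Main.v *)
From Stdlib Require Import NArith.
Require Import Defs.
From mathcomp Require Import all_boot all_order all_algebra.
From mathcomp Require Import zify.

(** Put v = p q and choose g in Z_v whose powers are pairwise distinct modulo p
    and modulo q, with g^(p-1) = 1 and g^((p-1)/2) = -1.  As (p-1)/2 is odd,
    <g> is the union of H = <g^2> and -H, and <g> has (v-1)/(p-1) orbits on Z_v \ {0},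
    all of size p-1.  Hence if the entries of (v-1)/(2(p-1)) pairs (a_k, b_k)
    meet every orbit, and so do the numbers a_k - b_k and a_k + b_k, then the
    pairs {h a_k, h b_k} with h in H form a partitionable set.  Such pairs were
    found by computer (local search) for each of the 48 admissible (p, q); that
    they meet every orbit is checked on the elements 1 + p j and p j only,
    since every residue prime to p is congruent to a power of g modulo p.
    The games (x, y, -x, -y), for {x, y} in a partitionable set, are then the
    initial round of a ZCPS-Wh(v). *)

Set Implicit Arguments.
Unset Strict Implicit.
Unset Printing Implicit Defensive.

Import GRing.Theory.
Local Open Scope ring_scope.

(** * Unordered pairs and a pigeonhole principle *)

Lemma set2_eq (T : finType) (a b c d : T) :
  [set a; b] = [set c; d] <-> (a = c /\ b = d) \/ (a = d /\ b = c).
Proof.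
split; last by case=> [[-> ->]|[-> ->]] //; rewrite setUC.
move=> E; have ha : a \in [set c; d] by rewrite -E set21.
have hb : b \in [set c; d] by rewrite -E set22.
have hc : c \in [set a; b] by rewrite E set21.
have hd : d \in [set a; b] by rewrite E set22.
move: ha hb hc hd; rewrite !inE.
case/orP=> /eqP-> /orP[]/eqP->; rewrite ?orbb => /eqP ? /eqP ?; subst; tauto.
Qed.

(** Pigeonhole: [D] lies in the image of [f], which has at most [#|A| = #|D|] elements. So the image
    is [D] itself and has full size, which forces [f] to be injective. *)
Lemma surjective_inj (A B : finType) (f : A -> B) (D : {set B}) :
    #|A| = #|D| -> (forall y, y \in D -> exists x, f x = y) ->
  injective f /\ (forall x, f x \in D).
Proof.
move=> cAD sf.
have sub : D \subset f @: [set: A].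
  by apply/subsetP=> y /sf[x <-]; apply: imset_f.
have c1 : (#|f @: [set: A]| <= #|A|)%N by rewrite -cardsT leq_imset_card.
have E : D = f @: [set: A].
  by apply/eqP; rewrite eqEcard sub -cAD.
split; last by move=> x; rewrite E imset_f.
have /imset_injP inj_f : #|f @: [set: A]| == #|[set: A]|.
  by rewrite -E -cAD cardsT.
by move=> x y; apply: inj_f; rewrite inE.
Qed.

(** * From pairs that cover the nonzero elements to a partitionable set *)

Section Starter.

Variables (G : finZmodType) (I : finType) (x y : I -> G).

(** Two booleans, a sign [s] and a choice [c], index the four elements that a pair contributes to
    each union. Both unions thus become images of [I * bool * bool], to which the pigeonhole
    principle applies. *)
Definition sgn (s : bool) (z : G) : G := if s then - z else z.

Definition member (i : I) (s c : bool) : G := sgn s (if c then y i else x i).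

Definition diffsum (i : I) (s c : bool) : G :=
  sgn s (if c then x i + y i else x i - y i).

Hypothesis card_G : #|G| = (4 * #|I|).+1.
Hypothesis member_surj : forall z, z != 0 -> exists i s c, member i s c = z.
Hypothesis diffsum_surj : forall z, z != 0 -> exists i s c, diffsum i s c = z.

Let uncurry (f : I -> bool -> bool -> G) (u : I * bool * bool) : G :=
  f u.1.1 u.1.2 u.2.

(* 4 #|I| values covering the 4 #|I| nonzero elements are all distinct and
   nonzero, so only coverage ever has to be checked. *)
Lemma surj_bij (f : I -> bool -> bool -> G) :
    (forall z, z != 0 -> exists i s c, f i s c = z) ->
  (forall i s c i' s' c', f i s c = f i' s' c' -> (i, s, c) = (i', s', c')) /\
  (forall i s c, f i s c != 0).
Proof.
move=> f_surj.
have [||inj nz] := @surjective_inj _ _ (uncurry f) [set~ 0].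
- by rewrite !card_prod card_bool cardsC1 card_G -mulnA mulnC.
- by move=> z; rewrite !inE => /f_surj[i [s [c <-]]]; exists (i, s, c).
split=> [i s c i' s' c' E|i s c]; first exact: inj.
by have := nz (i, s, c); rewrite !inE.
Qed.

Lemma member_inj i s c i' s' c' :
  member i s c = member i' s' c' -> [/\ i = i', s = s' & c = c'].
Proof. by have [inj _ /inj[]] := surj_bij member_surj. Qed.

Lemma member_neq0 i s c : member i s c != 0.
Proof. by have [_ nz] := surj_bij member_surj; apply: nz. Qed.

Lemma diffsum_inj i s c i' s' c' :
  diffsum i s c = diffsum i' s' c' -> [/\ i = i', s = s' & c = c'].
Proof. by have [inj _ /inj[]] := surj_bij diffsum_surj. Qed.

Lemma diffsum_neq0 i s c : diffsum i s c != 0.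
Proof. by have [_ nz] := surj_bij diffsum_surj; apply: nz. Qed.

Lemma memberN i s c : member i (~~ s) c = - member i s c.
Proof. by case: s; rewrite /member /= ?opprK. Qed.

(** This ties opponent pairs to the second union. Equal signs produce a difference, opposite signs a
    sum; with equal signs and [c] true the difference is taken in the order y - x, which costs one
    extra change of sign. *)
Lemma memberB i s t c :
  member i s c - member i t (~~ c) = diffsum i (s (+) (c && (s == t))) (s != t).
Proof.
by case: s t c => [] [] []; rewrite /member /diffsum /= ?opprK ?opprD ?opprK // addrC.
Qed.

Definition starter_pairs : {set {set G}} := [set [set x i; y i] | i : I].

(** Equal pairs share the entry [x i], and a member determines its index. Distinct indices therefore
    give distinct pairs, so there are exactly (v-1)/4 of them. *)
Lemma starter_pairs_inj : injective (fun i => [set x i; y i]).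
Proof.
move=> i j /set2_eq E.
have [c E'] : exists c, member i false false = member j false c.
  by rewrite /member; case: E => [[-> _]|[-> _]]; [exists false | exists true].
by have [] := member_inj E'.
Qed.

Lemma xy_neq i : x i != y i.
Proof. by have := diffsum_neq0 i false false; rewrite /diffsum /= subr_eq0. Qed.

Lemma in_pm (a b z : G) :
  reflect (exists s c, z = sgn s (if c then b else a)) (z \in pm [set a; b]).
Proof.
rewrite /pm; apply: (iffP idP) => [|[s [c ->]]].
  case/setUP=> [/set2P[]->|/imsetP[w /set2P[]-> ->]].
  - by exists false, false.
  - by exists false, true.
  - by exists true, false.
  - by exists true, true.
apply/setUP; case: s => /=; [right; apply: imset_f|left];
  by case: c; rewrite ?set21 ?set22.
Qed.

Theorem starter_partitionable : partitionable_set starter_pairs.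
Proof.
have inv (u : G * G) : [set u.1; u.2] \in starter_pairs ->
    exists i, u = (x i, y i) \/ u = (y i, x i).
  case: u => a b /= /imsetP[i _ /set2_eq E]; exists i.
  by case: E => [[-> ->]|[-> ->]]; [left|right].
split.
- by rewrite card_G -addn1 mulnC modnMDl.
- rewrite card_imset; last exact: starter_pairs_inj.
  by rewrite card_G subn1 mulKn.
- by move=> P /imsetP[i _ ->]; rewrite cards2 xy_neq.
- apply/setP=> z; rewrite !inE; apply/bigcupP/idP.
    case=> u /inv[i [->|->]] /in_pm[s [c ->]] /=.
      exact: member_neq0 i s c.
    (* The ordering (y, x) of the pair exchanges the two values of [c]. *)
    by have := member_neq0 i s (~~ c); rewrite /member; case: c.
  case/member_surj=> i [s [c <-]]; exists (x i, y i); first exact: imset_f.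
  by apply/in_pm; exists s, c.
- apply/setP=> z; rewrite !inE; apply/bigcupP/idP.
    case=> u /inv[i [->|->]] /in_pm[s [c ->]] /=.
      exact: diffsum_neq0 i s c.
    (* Reversing the pair negates the difference ([c] false) and fixes the sum ([c] true). *)
    have := diffsum_neq0 i (s (+) ~~ c) c; rewrite /diffsum.
    by case: s; case: c; rewrite /= ?opprB // addrC.
  case/diffsum_surj=> i [s [c <-]]; exists (x i, y i); first exact: imset_f.
  by apply/in_pm; exists s, c.
Qed.

(** * The whist tournament generated by the starter *)

Definition starter_game (j : G) (i : I) : game G :=
  shift_game j (x i, y i, - x i, - y i).

Definition starter_round (j : G) : round G := [set starter_game j i | i : I].

Lemma in_players j i z :
  reflect (exists s c, z = member i s c + j) (z \in players (starter_game j i)).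
Proof.
apply: (iffP idP) => [|[s [c ->]]].
  rewrite !inE -!orbA => /or4P[]/eqP->.
  - by exists false, false.
  - by exists false, true.
  - by exists true, false.
  - by exists true, true.
by case: s c => [] []; rewrite !inE eqxx ?orbT.
Qed.

Lemma starter_game_inj j i j' i' :
  starter_game j i = starter_game j' i' -> j = j' -> i = i'.
Proof.
move=> E; have: x i + j \in players (starter_game j' i').
  by rewrite -E; apply/in_players; exists false, false.
case/in_players=> s [c E'] jj'; move: E'; rewrite jj' => /addIr E'.
by have [] := @member_inj i false false _ _ _ E'.
Qed.

Lemma in_partners j i a b :
  reflect (exists s c, a = member i s c + j /\ b = - member i s c + j)
          ([set a; b] \in partner_pairs (starter_game j i)).
Proof.
apply: (iffP set2P) => [[]/set2_eq[][-> ->]|[s [c [-> ->]]]].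
- by exists false, false.
- by exists true, false; rewrite /member /= opprK.
- by exists false, true.
- by exists true, true; rewrite /member /= opprK.
case: s c => [] [] /=; rewrite /member /= ?opprK.
- by right; rewrite setUC.
- by left; rewrite setUC.
- by right.
- by left.
Qed.

(** Opponents are always a translate of ±x and a translate of ±y, and all four combinations of signs
    occur. Hence [s] and [t] are free, while [c] records which of the two kinds [a] is. *)
Lemma in_opponents j i a b :
  reflect (exists s t c, a = member i s c + j /\ b = member i t (~~ c) + j)
          ([set a; b] \in opponent_pairs (starter_game j i)).
Proof.
rewrite !inE -!orbA; apply: (iffP or4P) => [|[s [t [c [-> ->]]]]].
  case=> /eqP/set2_eq[][-> ->].
  - by exists false, false, false.
  - by exists false, false, true.
  - by exists true, true, false.
  - by exists true, true, true.
  - by exists false, true, false.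
  - by exists true, false, true.
  - by exists false, true, true.
  - by exists true, false, false.
case: s t c => [] [] [] /=; rewrite /member /=.
- by constructor 2; rewrite setUC eqxx.
- by constructor 2; rewrite eqxx.
- by constructor 3; rewrite setUC eqxx.
- by constructor 4; rewrite setUC eqxx.
- by constructor 4; rewrite eqxx.
- by constructor 3; rewrite eqxx.
- by constructor 1; rewrite setUC eqxx.
- by constructor 1; rewrite eqxx.
Qed.

(** A nonzero element killed by 2 would be a member equal to its own negative, that is, to the
    member with the opposite sign; but members with different signs are distinct. *)
Lemma double_inj : injective (fun w : G => w *+ 2).
Proof.
move=> v w E; apply/eqP; rewrite -subr_eq0; apply/negPn/negP.
case/member_surj=> i [s [c E']].
have: member i s c = member i (~~ s) c.
  by apply/eqP; rewrite memberN -addr_eq0 E' -mulr2n mulrnBl E subrr.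
by case/member_inj; case: s {E'}.
Qed.

Lemma card_starter_players j g : g \in starter_round j -> #|players g| = 4%N.
Proof.
case/imsetP=> i _ ->.
have -> : players (starter_game j i) =
    [set member i u.1 u.2 + j | u : bool * bool].
  apply/setP=> z; apply/in_players/imsetP => [[s [c ->]]|[[s c] _ ->]].
    by exists (s, c).
  by exists s, c.
rewrite card_imset ?card_prod ?card_bool // => -[s c] [s' c'] /addIr.
by case/member_inj=> _ /= -> ->.
Qed.

Lemma card_starter_round j : #|starter_round j| = #|I|.
Proof. by rewrite card_imset // => i i' /starter_game_inj; apply. Qed.

Lemma starter_round_disjoint j z :
  (#|[set g in starter_round j | z \in players g]| <= 1)%N.
Proof.
apply/card_le1_eqP=> g g'; rewrite !inE.
case/andP=> /imsetP[i _ ->] /in_players[s [c ->]].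
case/andP=> /imsetP[i' _ ->] /in_players[s' [c' /addIr]].
by case/member_inj=> ->.
Qed.

Lemma in_starter_round j g :
  reflect (exists i, g = starter_game j i) (g \in starter_round j).
Proof.
by apply: (iffP imsetP) => [[i _ ->]|[i ->]]; exists i.
Qed.

(** The players of round [j] are the translates by [j] of all the members, and these are exactly the
    nonzero elements. Only [j] itself is left out. *)
Lemma starter_round_bye j z :
  [forall g in starter_round j, z \notin players g] = (j == z).
Proof.
apply/forall_inP/eqP => [all_notin|-> g /in_starter_round[i ->]].
  apply/eqP; rewrite eq_sym -subr_eq0; apply/negPn/negP.
  case/member_surj=> i [s [c E]].
  have /negP[] := all_notin (starter_game j i) (imset_f _ isT).
  by apply/in_players; exists s, c; rewrite E subrK.
apply/in_players=> -[s [c /eqP]]; rewrite eq_sym -subr_eq0 addrK.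
by rewrite (negPf (member_neq0 i s c)).
Qed.

(** Partners have the form a = m + j and b = -m + j. So a - b = 2m determines the member m, as
    doubling is injective, and then j = a - m determines the round. *)
Lemma card_starter_partners a b : a != b ->
  #|[set u : G * game G |
      (u.2 \in starter_round u.1) && ([set a; b] \in partner_pairs u.2)]| = 1%N.
Proof.
(* On a finite group the injective doubling map is bijective; [h] is halving. *)
move=> ab; have [h _ hK] := injF_bij double_inj.
have w_neq0 : h (a - b) != 0.
  by apply: contra ab => /eqP E; rewrite -subr_eq0 -[a - b]hK E mul0rn.
have [i [s [c E]]] := member_surj w_neq0.
have E2 : member i s c *+ 2 = a - b by rewrite E hK.
set j := a - member i s c.
apply/eqP/cards1P; exists (j, starter_game j i); apply/setP=> -[j' g].
rewrite !inE xpair_eqE /=; apply/andP/andP=> [[]|[/eqP-> /eqP->]].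
  case/in_starter_round=> i' -> /in_partners[s' [c' [Ea Eb]]].
  have: member i' s' c' = member i s c.
    apply: double_inj; rewrite E2 Ea Eb opprD addrACA subrr addr0 opprK.
    by rewrite mulr2n.
  case/member_inj=> ? ? ?; subst i' s' c'.
  have jj' : j' = j by rewrite /j Ea addrAC subrr add0r.
  by rewrite jj' !eqxx.
split; first by apply/in_starter_round; exists i.
apply/in_partners; exists s, c; split; first by rewrite addrC subrK.
rewrite /j addrCA -opprD -mulr2n E2 opprB.
by rewrite addrC subrK.
Qed.

(** The difference a - b is [diffsum i s f] for exactly one triple. This fixes the base game [i],
    but leaves open whether [a] descends from ±x or from ±y. Each choice of [c] forces the signs and
    the round, which gives the two games. *)
Lemma card_starter_opponents a b : a != b ->
  #|[set u : G * game G |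
      (u.2 \in starter_round u.1) && ([set a; b] \in opponent_pairs u.2)]| = 2%N.
Proof.
move=> ab; have /diffsum_surj[i [s [f E]]] : a - b != 0 by rewrite subr_eq0.
(* Solves the sign equation of [memberB]: there [s == t] is [~~ f], so the sign of the member behind
   [a] is [s], corrected when [c] holds and [f] does not. *)
pose S c := s (+) (c && ~~ f).
pose j c := a - member i (S c) c.
(* The two games lie in different rounds, since members with different [c] are distinct. *)
have jN : j true != j false.
  apply/eqP=> /addrI/oppr_inj/member_inj[_ _].
  by [].
have -> : [set u : G * game G |
    (u.2 \in starter_round u.1) && ([set a; b] \in opponent_pairs u.2)] =
    [set (j c, starter_game (j c) i) | c : bool].
  apply/setP=> -[j' g]; rewrite !inE /=; apply/andP/imsetP=> [[]|[c _ [-> ->]]].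
    case/in_starter_round=> i' -> /in_opponents[s' [t [c [Ea Eb]]]].
    have: diffsum i' (s' (+) (c && (s' == t))) (s' != t) = diffsum i s f.
      by rewrite -memberB E Ea Eb opprD addrACA subrr addr0.
    case/diffsum_inj=> ? Es Ef; subst i'.
    have ES : S c = s' by rewrite /S -Es -Ef negbK addbK.
    have -> : j' = j c by rewrite /j ES Ea addrAC subrr add0r.
    by exists c.
  split; first by apply/in_starter_round; exists i.
  apply/in_opponents; exists (S c), (S c (+) f), c.
  split; first by rewrite addrC subrK.
  have: member i (S c) c - member i (S c (+) f) (~~ c) = a - b.
    by rewrite memberB -E /S; case: (s) (f) (c) => [] [] [].
  rewrite /j => E'; rewrite addrCA -opprB E' opprB.
  by rewrite addrC subrK.
rewrite card_imset ?card_bool // => -[] [] // /(congr1 fst) /= /eqP.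
  by rewrite (negPf jN).
by rewrite eq_sym (negPf jN).
Qed.

End Starter.

(** Round [j] is the initial round translated by [j], so the tournament is cyclic by construction.
    The round number doubles as a group element and as the player who sits out. *)
Theorem starter_whist (v : nat) (I : finType) (x y : I -> 'Z_v) :
    (1 < v)%N -> v = (4 * #|I|).+1 ->
    (forall z, z != 0 -> exists i s c, member x y i s c = z) ->
    (forall z, z != 0 -> exists i s c, diffsum x y i s c = z) ->
  exists R : 'I_v -> round 'Z_v, ZCPS_whist R.
Proof.
(* Once [v] has the form [n.+2], the types ['I_v] and ['Z_v] are convertible. *)
case: v x y => [|[|n]] // x y _ vE xy_surj df_surj.
have cardZ : #|'Z_n.+2| = (4 * #|I|).+1 by rewrite card_ord.
exists (fun j => starter_round x y (j : 'Z_n.+2)); split.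
- split.
  + exact: card_ord.
  + by rewrite vE -addn1 mulnC modnMDl.
  + by move=> j g; apply: card_starter_players.
  + by move=> j; rewrite card_starter_round // vE subn1 mulKn.
  + by move=> j z; apply: starter_round_disjoint.
  + move=> z; apply/eqP/cards1P; exists z; apply/setP=> j.
    by rewrite !inE starter_round_bye.
  + by move=> a b; apply: card_starter_partners.
  + by move=> a b; apply: card_starter_opponents.
- move=> i j ij; have -> : (j : 'Z_n.+2) = (i : 'Z_n.+2) + 1.
    (* No wrap-around occurs: [i.+1] equals [j], which is below v. *)
    by apply: val_inj; rewrite /= ij modn_small ?addn1 // -ij.
  rewrite /starter_round -imset_comp; apply: eq_imset => k /=.
  by rewrite /starter_game /= !addrA.
- move=> i i0; have -> : i = 0 :> 'Z_n.+2 by apply: val_inj.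
  by apply/forall_inP; rewrite starter_round_bye.
- move=> i i0; have -> : i = 0 :> 'Z_n.+2 by apply: val_inj.
  apply/setP=> P; apply/bigcupP/imsetP => [[g /in_starter_round[k ->]]|[z]].
    case/set2P=> ->.
      exists (x k); last by rewrite !addr0.
      by rewrite !inE (member_neq0 cardZ xy_surj k false false).
    exists (y k); last by rewrite !addr0.
    by rewrite !inE (member_neq0 cardZ xy_surj k false true).
  rewrite !inE => /xy_surj[k [s [c <-]]] ->.
  exists (starter_game x y 0 k); first by apply/in_starter_round; exists k.
  by apply/in_partners; exists s, c; rewrite !addr0.
Qed.

(** * Transfer from binary integers to Z_v *)

Section Residues.

Variable v : nat.

(** The numerical checks run in binary arithmetic, so that [vm_compute] can evaluate them; this map
    carries their results into the ring. *)
Definition residue (b : N) : 'Z_v := (nat_of_bin b)%:R.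

Lemma residueD a b : residue (N.add a b) = residue a + residue b.
Proof. by rewrite /residue -natrD; congr (_%:R); lia. Qed.

Lemma residueM a b : residue (N.mul a b) = residue a * residue b.
Proof. by rewrite /residue -natrM; congr (_%:R); lia. Qed.

Variable V : N.
Hypotheses (v_gt1 : (1 < v)%N) (VE : nat_of_bin V = v).

Lemma residueV : residue V = 0.
Proof. by rewrite /residue VE pchar_Zp. Qed.

Lemma residue_mod a : residue (N.modulo a V) = residue a.
Proof.
have V0 : V <> 0%num by move=> V0; move: VE v_gt1; rewrite V0 => <-.
rewrite {2}(N.div_mod a V V0) residueD residueM residueV.
by rewrite mul0r add0r.
Qed.

End Residues.

(** * The Boolean test applied to a certificate *)

Definition powers (g V : N) (n : nat) : seq N :=
  traject (fun t => N.modulo (N.mul t g) V) 1%num n.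

(* Translates of w by T = <g>: all of them if p divides w, else the only one
   congruent to 1 modulo p.  Tp is T reduced modulo p and T' lists the inverses
   of the elements of T in the same order. *)
Definition normal_forms (P V : N) (T T' Tp : seq N) (w : N) : seq N :=
  if N.modulo w P == 0%num then [seq N.modulo (N.mul t w) V | t <- T]
  else [:: N.modulo (N.mul (nth 1%num T' (index (N.modulo w P) Tp)) w) V].

(** The order of [T'] comes from g^(p-1) = 1: the inverse of g^i is g^(p-1-i). The two lists to be
    met are 1 + p j for 0 <= j < q and p j for 0 < j < q. *)
Definition covers (p q : nat) (T : seq N) (ws : seq N) : bool :=
  let P := bin_of_nat p in
  let V := N.mul P (bin_of_nat q) in
  let T' := 1%num :: rev (behead T) in
  let Tp := [seq N.modulo t P | t <- T] in
  let L := flatten [seq normal_forms P V T T' Tp w | w <- ws] in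
  all (mem L) (traject (N.add P) 1%num q) &&
  all (mem L) (traject (N.add P) P q.-1).

Definition is_primitive (p : nat) (T : seq N) : bool :=
  all (mem [seq N.modulo t (bin_of_nat p) | t <- T])
      (traject N.succ 1%num p.-1).

(* (p, q, g, [:: (a_k, b_k)]); since natural-number subtraction is truncated,
   a_k - b_k is entered as a_k + (v - 1) b_k. *)
Definition certificate : Type := nat * nat * N * seq (N * N).

(** Oddness of p and of (p-1)/2 says that p is 3 modulo 4. The first equation with [N.succ] says
    that g^((p-1)/2) reduces to v - 1, that is, to -1. The second is the count v = 4 ((p-1)/2) n + 1
    for n pairs, which upgrades coverage to a partition. *)
Definition certifies (C : certificate) : bool :=
  let: (p, q, g, ps) := C in
  let V := N.mul (bin_of_nat p) (bin_of_nat q) in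
  let T := powers g V p.-1 in
  [&& odd p, odd p./2, N.succ (nth 0%num T p./2) == V,
      N.succ (N.mul 4 (N.mul (bin_of_nat p./2) (bin_of_nat (size ps)))) == V,
      is_primitive p T,
      covers p q T ([seq c.1 | c <- ps] ++ [seq c.2 | c <- ps]) &
      covers p q T ([seq N.add c.1 (N.mul (N.pred V) c.2) | c <- ps]
                    ++ [seq N.add c.1 c.2 | c <- ps])].

Lemma nat_of_modN (a b : N) : nat_of_bin (N.modulo a b) = (a %% b)%N.
Proof.
have [->|b0] := eqVneq b 0%num; first by case: a.
have /eqP b_neq0 := b0; have lt_mod := N.mod_lt a b b_neq0.
have -> : nat_of_bin a = (N.div a b * b + N.modulo a b)%N.
  by have := N.div_mod a b b_neq0; nia.
by rewrite modnMDl modn_small //; lia.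
Qed.

Lemma bin_of_nat_iter (r : nat) : bin_of_nat r.+1 = iter r N.succ 1%num.
Proof.
elim: r => [|r IH]; first by [].
by apply: (can_inj nat_of_binK); rewrite iterS -IH; have := bin_of_natK; lia.
Qed.

Lemma nat_of_mulN (p q : nat) :
  nat_of_bin (N.mul (bin_of_nat p) (bin_of_nat q)) = (p * q)%N.
Proof. by have := bin_of_natK p; have := bin_of_natK q; lia. Qed.

Lemma nat_of_iter_addN (P a : N) (j : nat) :
  nat_of_bin (iter j (N.add P) a) = (nat_of_bin a + nat_of_bin P * j)%N.
Proof. by elim: j => [|j IH] /=; lia. Qed.

(** * Soundness of the coverage test *)

Section Soundness.

Variables (p q : nat) (g : N).
Let v := (p * q)%N.
Let P := bin_of_nat p.
Let V := N.mul P (bin_of_nat q).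
Let T := powers g V p.-1.
Let gamma : 'Z_v := residue v g.

Hypotheses (v_gt1 : (1 < v)%N) (p_odd : odd p) (m_odd : odd p./2).
Hypothesis gammaN1 : gamma ^+ p./2 = -1.
Hypothesis T_prim : is_primitive p T.

Let PE : nat_of_bin P = p. Proof. exact: bin_of_natK. Qed.
Let VE : nat_of_bin V = v. Proof. exact: nat_of_mulN. Qed.
Let pE : p = (p./2).*2.+1.
Proof. by have := odd_double_half p; rewrite p_odd. Qed.

Lemma gamma_order : gamma ^+ p.-1 = 1.
Proof. by rewrite [p in p.-1]pE /= -mul2n mulnC exprM gammaN1 sqrrN expr1n. Qed.

Lemma residue_power i :
  residue v (iter i (fun t => N.modulo (N.mul t g) V) 1%num) = gamma ^+ i.
Proof.
by elim: i => //= i IH; rewrite residue_mod // residueM IH -exprSr.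
Qed.

Lemma mem_powers t : t \in T -> exists e, residue v t = gamma ^+ e.
Proof. by case/trajectP=> e _ ->; exists e; apply: residue_power. Qed.

(** A multiple of p is looked up directly in the second list. Any other z is congruent to some g^i
    modulo p; multiplied by g^(p-1-i) it becomes congruent to 1 modulo p, is found in the first
    list, and is recovered by multiplying by g^i. *)
Lemma covers_sound ws z : covers p q T ws -> z != 0 ->
  exists e w, w \in ws /\ z = gamma ^+ e * residue v w.
Proof.
set T' := 1%num :: rev (behead T).
set Tp := [seq N.modulo t P | t <- T].
set L := flatten [seq normal_forms P V T T' Tp w | w <- ws].
case/andP=> /= /allP cov1 /allP cov0 z_neq0.
(* It suffices that every normal form is some power of g times some [w]. Which power the lookup by
   [index] selects affects only the success of the computation. *)
have L_sound u : u \in L ->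
    exists e w, w \in ws /\ residue v u = gamma ^+ e * residue v w.
  case/flattenP=> s /mapP[w w_ws ->] us.
  suff [t [e [te ->]]] : exists t e,
      residue v t = gamma ^+ e /\ u = N.modulo (N.mul t w) V.
    by exists e, w; rewrite residue_mod // residueM te.
  move: us; rewrite /normal_forms; case: ifP => _.
    by case/mapP=> t /mem_powers[e te] ->; exists t, e.
  rewrite inE => /eqP->; set i := index _ _.
  suff [e te] : exists e, residue v (nth 1%num T' i) = gamma ^+ e.
    by exists (nth 1%num T' i), e.
  (* A failed lookup returns the default 1, which is still the power g^0. *)
  have [iT|iT] := ltnP i (size T'); last by rewrite nth_default //; exists 0%N.
  have: nth 1%num T' i \in T' by apply: mem_nth.
  rewrite inE mem_rev => /orP[/eqP->|/mem_behead/mem_powers//].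
  by exists 0%N.
have reach1 l : l = 1 %[mod p] -> (l < v)%N ->
    exists e w, w \in ws /\ l%:R = gamma ^+ e * residue v w :> 'Z_v.
  move=> l1 lv.
  have p_gt1 : (1 < p)%N by case: (p) p_odd m_odd => [|[]].
  have lE : l = (1 + p * (l %/ p))%N.
    by rewrite {1}(divn_eq l p) l1 modn_small // addnC mulnC.
  have lq : (l %/ p < q)%N by rewrite ltn_divLR ?(ltnW p_gt1) // mulnC.
  have /L_sound[e [w [ww E]]] : iter (l %/ p) (N.add P) 1%num \in L.
    by apply/cov1/trajectP; exists (l %/ p)%N.
  exists e, w; split=> //; rewrite -E /residue nat_of_iter_addN PE.
  by rewrite {1}lE.
set k := nat_of_ord z; have zE : z = k%:R by rewrite natr_Zp.
have kv : (k < v)%N by apply: leq_trans (ltn_ord z) _; rewrite Zp_cast.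
have p_gt0 : (0 < p)%N by rewrite pE.
have [/dvdnP[j kE]|pNk] := boolP (p %| k)%N.
  (* The second list starts at p, so p (j+1) stands at position j; the multiple 0 is excluded by
     [z_neq0]. *)
  case: j kE => [|j] kE; first by rewrite zE kE eqxx in z_neq0.
  have jq : (j < q.-1)%N.
    by move: kv; rewrite kE /v mulnC ltn_pmul2l //; case: (q).
  have /L_sound[e [w [ww E]]] : iter j (N.add P) P \in L.
    by apply/cov0/trajectP; exists j.
  exists e, w; split=> //; rewrite -E /residue nat_of_iter_addN PE zE kE.
  by congr (_%:R); rewrite mulSn mulnC.
(* Equality in Z_v descends to congruence modulo p because p divides v. *)
have eq_modv a b : a%:R = b%:R :> 'Z_v -> a = b %[mod p].
  move/(congr1 (@nat_of_ord _)); rewrite !val_Zp_nat // => ab.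
  by rewrite -(modn_dvdm a (dvdn_mulr q (dvdnn p))) ab modn_dvdm ?dvdn_mulr.
have [i ip gik] : exists2 i, (i < p.-1)%N & nat_of_bin g ^ i = k %[mod p].
  have: bin_of_nat (k %% p) \in traject N.succ 1%num p.-1.
    have r_gt0 : (0 < k %% p)%N by rewrite lt0n.
    (* The list of nonzero residues starts at 1, so r stands at position r - 1. *)
    apply/trajectP; exists (k %% p).-1.
      by rewrite -ltnS !prednK // ltn_mod.
    by rewrite -{1}(prednK r_gt0) bin_of_nat_iter.
  move/(allP T_prim)/mapP=> [t /trajectP[i ip ->]].
  set u := iter _ _ _ => /(congr1 nat_of_bin); rewrite bin_of_natK => kE.
  exists i => //; have -> : (k %% p = u %% p)%N.
    by rewrite kE nat_of_modN bin_of_natK.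
  by apply: eq_modv; rewrite natrX -/(residue v u) residue_power.
(* The factor is the inverse of gamma^i, so the product is congruent to 1 modulo p and [reach1]
   applies. *)
have [e [w [ww zE']]] : exists e w,
    w \in ws /\ z * gamma ^+ (p.-1 - i) = gamma ^+ e * residue v w.
  have -> : z * gamma ^+ (p.-1 - i) =
      ((k * nat_of_bin g ^ (p.-1 - i)) %% v)%:R.
    by rewrite Zp_nat_mod // natrM natrX -zE.
  apply: reach1; last by rewrite ltn_mod ltnW.
  rewrite modn_dvdm ?dvdn_mulr // -modnMml -gik modnMml -expnD subnKC ?(ltnW ip) //.
  by apply: eq_modv; rewrite natrX -/(residue v g) gamma_order.
exists (i + e)%N, w; split=> //.
by rewrite exprD -mulrA -zE' mulrCA -exprD subnKC ?(ltnW ip) // gamma_order mulr1.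
Qed.

End Soundness.

(** * Multiplying the base pairs by the subgroup H *)

Section Families.

Variables (p q : nat) (g : N) (ps : seq (N * N)).
Let v := (p * q)%N.
Let V := N.mul (bin_of_nat p) (bin_of_nat q).
Let T := powers g V p.-1.
Let gamma : 'Z_v := residue v g.

Hypotheses (v_gt1 : (1 < v)%N) (cert : certifies (p, q, g, ps)).

Let I : finType := ('I_(p./2) * 'I_(size ps))%type.

(** The first component of [i] selects an element of H = <g^2> through an even exponent below p - 1;
    the second selects a base pair. *)
Definition family_fst (i : I) : 'Z_v :=
  gamma ^+ (2 * i.1) * residue v (nth (0, 0) ps i.2).1%num.

Definition family_snd (i : I) : 'Z_v :=
  gamma ^+ (2 * i.1) * residue v (nth (0, 0) ps i.2).2%num.

Lemma family_card : v = (4 * #|{: I}|).+1.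
Proof.
case/and5P: cert => _ _ _ /eqP/(congr1 nat_of_bin) + _.
rewrite card_prod !card_ord /v -{2}(bin_of_natK p) -{2}(bin_of_natK q).
rewrite -{2}(bin_of_natK p./2) -{2}(bin_of_natK (size ps)); lia.
Qed.

Let p_odd : odd p. Proof. by case/and3P: cert. Qed.
Let m_odd : odd p./2. Proof. by case/and3P: cert. Qed.
Let T_prim : is_primitive p T. Proof. by case/and5P: cert => _ _ _ _ /andP[]. Qed.
Let m_gt0 : (0 < p./2)%N. Proof. by case: p./2 m_odd. Qed.

Let VE : nat_of_bin V = v. Proof. exact: nat_of_mulN. Qed.

Lemma gamma_halfN1 : gamma ^+ p./2 = -1.
Proof.
case/and3P: cert => _ _ /andP[/eqP + _].
(* [nth_traject] requires the starting value 1 as default. The index m = (p-1)/2 is in range because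
   m > 0 gives m < 2m = p - 1. *)
rewrite (set_nth_default 1%num) ?size_traject; last first.
  by have := odd_double_half p; rewrite p_odd; move: m_gt0; lia.
rewrite nth_traject; last first.
  by have := odd_double_half p; rewrite p_odd; move: m_gt0; lia.
rewrite -/V -N.add_1_l => /(congr1 (residue v)).
rewrite residueD (residueV v_gt1 VE) (residue_power g v_gt1) => /eqP.
by rewrite addrC addr_eq0 => /eqP.
Qed.

(** Put m = (p-1)/2. An even power of gamma lies in H, and its exponent reduces because gamma^(2m) =
    1. For odd e, gamma^e = -gamma^(e+m), where e + m is even since m is odd. Thus <g> is the union
    of H and -H. *)
Lemma gamma_power_sgn e (u : 'Z_v) : exists s (a : 'I_(p./2)),
  gamma ^+ e * u = sgn s (gamma ^+ (2 * a) * u).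
Proof.
have gamma2 : (gamma ^+ 2) ^+ p./2 = 1.
  by rewrite -exprM mulnC exprM gamma_halfN1 sqrrN expr1n.
have even_case d : exists a : 'I_(p./2), gamma ^+ d.*2 = gamma ^+ (2 * a).
  exists (Ordinal (ltn_pmod d m_gt0)).
  by rewrite /= -mul2n !exprM expr_mod.
case: (boolP (odd e)) => eo; last first.
  have [a E] := even_case e./2; exists false, a.
  by rewrite -[e]odd_double_half (negPf eo) E.
have [a E] := even_case (e + p./2)./2; exists true, a.
rewrite /= -E -mulNr; congr (_ * _).
have -> : (e + p./2)./2.*2 = (e + p./2)%N.
  by rewrite -[RHS]odd_double_half oddD eo m_odd.
by rewrite exprD gamma_halfN1 mulrN1 opprK.
Qed.

Lemma family_member_surj z : z != 0 ->
  exists i s c, member family_fst family_snd i s c = z.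
Proof.
move=> z0; case/and5P: cert => _ _ _ _ /and3P[_ cov _].
have [e [w [ww ->]]] :=
  covers_sound v_gt1 p_odd m_odd gamma_halfN1 T_prim cov z0.
have [s [a ->]] := gamma_power_sgn e (residue v w).
move: ww; rewrite mem_cat => /orP[]/mapP[c /(nthP (0, 0)%num)[b bs <-] ->].
  by exists (a, Ordinal bs), s, false.
by exists (a, Ordinal bs), s, true.
Qed.

Lemma family_diffsum_surj z : z != 0 ->
  exists i s c, diffsum family_fst family_snd i s c = z.
Proof.
move=> z0; case/and5P: cert => _ _ _ _ /and3P[_ _ cov].
have [e [w [ww ->]]] :=
  covers_sound v_gt1 p_odd m_odd gamma_halfN1 T_prim cov z0.
have [s [a ->]] := gamma_power_sgn e (residue v w).
have predV : residue v (N.pred V) = -1.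
  apply/eqP; rewrite -addr_eq0 -(residueV v_gt1 VE).
  rewrite -[1]/(residue v 1%num) -residueD.
  by apply/eqP; congr residue; move: v_gt1; rewrite -VE; lia.
move: ww; rewrite mem_cat => /orP[]/mapP[c /(nthP (0, 0)%num)[b bs <-] ->].
  exists (a, Ordinal bs), s, false.
  by rewrite residueD residueM predV mulN1r mulrBr.
exists (a, Ordinal bs), s, true.
by rewrite residueD mulrDr.
Qed.

Theorem certifies_sound :
  (exists S : {set {set 'Z_v}}, partitionable_set S) /\
  (exists R : 'I_v -> round 'Z_v, ZCPS_whist R).
Proof.
split; last first.
  exact: starter_whist v_gt1 family_card family_member_surj family_diffsum_surj.
exists (starter_pairs family_fst family_snd).
apply: starter_partitionable family_member_surj family_diffsum_surj.
by rewrite card_ord Zp_cast // family_card.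
Qed.

End Families.

(** * The certificates, ordered by q and then by p *)

Definition certificates : seq certificate := [::
 (7%N, 7%N, 19,
  [:: (1,11); (3,4); (6,9); (7,20)]);
 (11%N, 11%N, 40,
  [:: (1,4); (2,24); (5,53); (10,51); (11,23); (19,56)]);
 (7%N, 19%N, 12,
  [:: (1,39); (2,16); (3,14); (4,32); (5,53); (6,31); (7,17); (8,38); (9,65);
      (10,63); (20,52)]);
 (19%N, 19%N, 116,
  [:: (1,145); (2,86); (3,78); (5,45); (6,114); (7,102); (8,9); (22,96);
      (24,59); (27,43)]);
 (23%N, 23%N, 28,
  [:: (1,68); (2,150); (5,67); (6,85); (7,206); (8,201); (13,120); (15,20);
      (23,86); (40,44); (47,64); (50,70)]);
 (7%N, 31%N, 26,
  [:: (1,83); (2,81); (3,42); (4,15); (5,94); (6,62); (9,22); (10,11);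
      (13,21); (14,73); (16,65); (19,71); (20,47); (23,77); (24,99); (29,36);
      (38,48); (40,63)]);
 (11%N, 31%N, 29,
  [:: (1,73); (2,108); (3,81); (4,35); (5,48); (6,82); (7,102); (10,61);
      (11,18); (16,40); (17,168); (26,32); (31,162); (33,37); (52,85);
      (65,99); (68,170)]);
 (31%N, 31%N, 115,
  [:: (1,103); (2,66); (3,128); (4,146); (5,443); (6,120); (7,70); (8,129);
      (9,192); (10,366); (11,412); (14,240); (32,59); (33,78); (39,62);
      (43,136)]);
 (7%N, 43%N, 80,
  [:: (1,46); (2,83); (4,94); (6,61); (7,133); (8,51); (9,41); (10,39);
      (13,23); (14,96); (16,90); (17,48); (20,26); (21,142); (25,55); (29,40);
      (32,92); (35,70); (36,63); (43,52); (45,62); (47,87); (66,127); (67,69);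
      (89,93)]);
 (43%N, 43%N, 19,
  [:: (1,828); (2,248); (4,30); (5,229); (6,755); (7,56); (8,404); (9,252);
      (10,604); (11,685); (12,111); (15,674); (17,52); (18,638); (21,400);
      (23,472); (25,102); (29,182); (37,528); (40,298); (43,364); (58,448)]);
 (47%N, 47%N, 67,
  [:: (1,358); (2,473); (3,796); (4,330); (5,419); (7,631); (8,91); (9,995);
      (11,466); (12,931); (14,730); (17,480); (21,470); (22,504); (23,160);
      (24,941); (32,261); (34,109); (36,483); (51,646); (58,948); (61,988);
      (80,92); (88,813)]);
 (59%N, 59%N, 506,
  [:: (1,1092); (2,490); (3,868); (4,564); (6,67); (7,1379); (9,687);
      (10,889); (11,1430); (12,865); (13,218); (15,912); (16,422); (17,995);
      (20,968); (21,304); (24,776); (25,767); (28,486); (29,1167); (41,996);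
      (43,109); (50,325); (54,470); (60,97); (65,961); (72,341); (80,439);
      (87,387); (96,306)]);
 (7%N, 67%N, 38,
  [:: (1,107); (2,209); (3,58); (4,198); (5,156); (6,106); (7,26); (8,23);
      (9,13); (10,48); (15,17); (16,234); (18,96); (21,154); (22,93);
      (27,117); (29,97); (30,36); (32,153); (34,85); (35,92); (40,221);
      (41,183); (42,125); (43,103); (45,68); (46,220); (47,91); (51,94);
      (54,129); (55,217); (57,120); (63,71); (67,206); (69,119); (78,98);
      (79,226); (95,105); (131,143)]);
 (23%N, 67%N, 5,
  [:: (1,381); (2,732); (3,521); (4,663); (6,57); (7,628); (8,216); (9,64);
      (11,383); (12,420); (14,501); (16,256); (17,126); (18,440); (19,398);
      (21,661); (22,424); (23,689); (24,48); (26,719); (28,165); (29,326);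
      (34,77); (38,488); (39,651); (44,636); (46,54); (47,389); (56,763);
      (67,514); (76,92); (81,729); (83,655); (102,362); (103,147)]);
 (67%N, 67%N, 279,
  [:: (1,1921); (2,1966); (3,64); (5,212); (6,778); (7,1778); (9,599);
      (14,242); (15,748); (17,685); (19,970); (23,187); (24,838); (25,618);
      (26,882); (28,660); (32,703); (33,59); (34,437); (37,2205); (43,124);
      (44,197); (46,324); (49,689); (53,274); (62,1426); (65,862); (67,460);
      (68,75); (69,271); (71,573); (74,538); (78,1437); (92,1159)]);
 (11%N, 71%N, 17,
  [:: (1,277); (2,68); (3,351); (5,232); (6,99); (7,60); (8,265); (9,234);
      (11,252); (12,183); (14,325); (16,347); (19,201); (20,305); (21,89);
      (22,161); (25,319); (26,330); (29,174); (30,149); (32,84); (36,64);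
      (37,120); (40,206); (42,198); (43,250); (48,77); (56,294); (57,96);
      (59,74); (61,193); (63,261); (71,257); (80,359); (82,129); (83,177);
      (105,259); (128,298); (147,245)]);
 (71%N, 71%N, 11,
  [:: (1,877); (2,2357); (4,2485); (5,745); (6,2051); (7,451); (8,1525);
      (9,580); (10,1484); (12,353); (13,1108); (14,996); (15,385); (16,78);
      (17,2419); (30,1195); (38,2456); (39,788); (45,400); (49,1110);
      (51,714); (56,1713); (59,180); (62,391); (63,719); (64,2087); (65,2061);
      (76,515); (87,560); (91,1889); (92,914); (93,700); (94,466); (95,1540);
      (248,350); (277,816)]);
 (7%N, 79%N, 24,
  [:: (1,211); (2,275); (3,127); (4,9); (5,192); (6,273); (7,236); (10,204);
      (11,121); (12,152); (13,22); (14,248); (15,176); (16,149); (17,198);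
      (19,122); (20,222); (26,28); (27,67); (29,260); (30,165); (31,206);
      (32,153); (34,85); (35,166); (37,108); (38,57); (39,181); (40,112);
      (43,49); (44,271); (54,182); (55,259); (58,175); (59,210); (60,197);
      (61,234); (62,101); (64,79); (66,179); (78,99); (82,188); (83,106);
      (90,98); (104,151); (105,125)]);
 (79%N, 79%N, 147,
  [:: (1,851); (2,1200); (3,2284); (4,14); (5,232); (6,138); (7,923); (8,45);
      (9,215); (10,2096); (13,718); (16,1435); (17,2850); (20,714); (21,255);
      (22,650); (29,941); (30,2784); (32,681); (34,744); (37,2056); (38,2285);
      (44,152); (47,831); (49,2892); (53,842); (57,2738); (64,1785); (67,388);
      (68,746); (79,663); (83,379); (91,756); (92,180); (94,2245); (106,338);
      (148,229); (289,410); (326,646); (502,618)]);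
 (83%N, 83%N, 269,
  [:: (1,1071); (2,1927); (3,43); (4,3425); (5,2116); (6,381); (7,1220);
      (8,2470); (9,676); (10,3285); (12,3051); (14,730); (15,2402); (16,839);
      (17,3256); (18,711); (21,2655); (23,635); (24,304); (26,3015);
      (28,2091); (30,2966); (31,546); (32,231); (33,651); (36,456); (39,2938);
      (41,2049); (44,1174); (50,272); (58,2961); (60,3012); (65,2461);
      (66,1854); (73,92); (79,373); (80,2468); (83,341); (85,647); (88,741);
      (90,2066); (175,673)]);
 (7%N, 103%N, 47,
  [:: (1,168); (2,156); (3,238); (4,179); (5,176); (6,227); (7,20); (8,55);
      (9,53); (10,317); (11,129); (12,23); (13,137); (15,60); (18,324);
      (19,267); (21,45); (22,183); (24,326); (26,330); (27,63); (28,252);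
      (29,320); (30,224); (33,357); (36,130); (37,171); (38,78); (40,301);
      (41,72); (42,67); (43,241); (52,311); (54,83); (57,263); (58,95);
      (59,340); (66,286); (68,195); (69,248); (70,343); (71,206); (73,91);
      (74,319); (75,144); (81,294); (82,351); (85,226); (88,143); (90,98);
      (97,240); (99,289); (100,285); (102,180); (105,207); (113,269);
      (115,332); (134,255); (150,223); (163,333)]);
 (103%N, 103%N, 43,
  [:: (1,1331); (2,3225); (3,2676); (4,1923); (5,5059); (6,4482); (7,2870);
      (8,3611); (9,1483); (10,776); (11,3122); (13,3568); (14,3366);
      (15,3363); (16,4579); (17,4249); (18,2943); (19,45); (20,720);
      (21,3118); (23,3337); (24,3385); (25,2970); (26,32); (29,2572); (31,80);
      (33,169); (34,819); (35,82); (36,2272); (41,5271); (42,3130); (49,5119);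
      (56,4715); (57,495); (60,1717); (64,265); (69,291); (70,2493);
      (76,3233); (77,806); (81,2534); (85,5226); (88,4434); (92,865);
      (98,4077); (99,896); (114,916); (138,4575); (161,204); (178,262);
      (412,921)]);
 (107%N, 107%N, 317,
  [:: (1,3525); (2,1701); (3,2596); (4,3963); (5,3565); (6,1555); (7,3693);
      (8,2235); (9,2344); (10,2532); (11,1202); (13,2024); (14,3864);
      (15,4644); (16,5436); (17,4484); (19,2551); (20,5320); (21,3424);
      (22,220); (25,3380); (26,467); (28,4396); (30,1191); (32,54); (34,5044);
      (35,4521); (38,453); (39,5363); (41,3807); (42,2448); (43,4625);
      (44,128); (46,862); (50,3221); (56,4618); (60,281); (61,2869); (62,337);
      (64,896); (66,227); (69,1576); (71,2136); (76,158); (82,3801);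
      (88,2835); (112,3500); (170,4738); (199,4255); (216,301); (219,807);
      (225,573); (352,672); (784,985)]);
 (7%N, 127%N, 108,
  [:: (1,122); (2,322); (3,106); (4,168); (5,411); (6,344); (7,361); (8,87);
      (9,305); (10,157); (11,264); (12,127); (13,206); (14,326); (15,379);
      (16,377); (17,171); (18,72); (19,363); (20,22); (21,270); (26,431);
      (27,164); (28,39); (29,137); (30,250); (31,147); (32,197); (34,350);
      (35,338); (36,269); (37,319); (40,202); (42,252); (43,175); (44,370);
      (46,287); (48,79); (51,315); (52,154); (53,245); (54,75); (57,314);
      (59,394); (61,114); (63,439); (69,267); (70,240); (71,163); (73,228);
      (76,398); (78,93); (81,195); (84,402); (85,408); (89,162); (94,113);
      (96,129); (97,286); (102,380); (103,262); (104,237); (110,160);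
      (118,260); (135,425); (138,301); (143,187); (151,336); (153,194);
      (169,405); (170,253); (193,236); (212,310); (220,244)]);
 (19%N, 127%N, 59,
  [:: (1,102); (2,563); (3,854); (4,224); (5,574); (6,792); (7,1181); (8,55);
      (9,16); (10,309); (12,299); (13,261); (14,776); (15,310); (17,258);
      (19,71); (20,311); (21,801); (23,340); (24,279); (25,798); (26,999);
      (28,255); (29,699); (30,661); (31,89); (32,738); (34,550); (35,506);
      (36,124); (37,527); (39,132); (46,864); (47,843); (48,88); (49,965);
      (54,796); (56,580); (57,760); (60,641); (64,780); (67,806); (68,1176);
      (69,1196); (72,728); (73,1042); (76,343); (85,1005); (86,1067);
      (87,561); (90,987); (91,598); (95,1142); (96,888); (100,297); (103,935);
      (126,795); (129,534); (134,358); (142,198); (146,241); (147,503);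
      (148,635); (155,196); (169,453); (188,331); (190,624)]);
 (43%N, 127%N, 5,
  [:: (1,325); (2,1283); (3,1114); (6,104); (7,2157); (8,2341); (9,2493);
      (11,513); (12,936); (14,1895); (16,1319); (17,2513); (18,869); (20,51);
      (21,944); (22,1976); (23,2424); (24,729); (26,1539); (27,2264);
      (29,2385); (32,1833); (38,406); (39,2542); (41,709); (42,411);
      (46,1731); (48,2081); (52,1608); (54,486); (57,213); (58,2076); (59,64);
      (61,1645); (63,215); (67,407); (68,308); (69,2459); (73,96); (74,1270);
      (76,2485); (77,2094); (78,2715); (84,2596); (89,153); (91,736);
      (92,848); (94,316); (95,314); (97,1935); (98,469); (106,571); (111,560);
      (114,1760); (139,822); (184,991); (204,269); (238,927); (241,1152);
      (244,823); (249,979); (301,646); (323,818); (579,779); (630,809)]);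
 (127%N, 127%N, 497,
  [:: (1,7124); (2,3526); (3,6166); (4,1135); (5,2758); (6,2292); (7,532);
      (9,5935); (10,6397); (11,1628); (12,1290); (13,4766); (15,2019);
      (16,4136); (17,7565); (18,5416); (19,6217); (21,6547); (24,2393);
      (25,6330); (27,4584); (28,840); (29,5838); (30,2251); (32,5624);
      (33,1471); (34,4759); (36,1849); (37,468); (39,3922); (40,805);
      (42,5969); (45,2614); (48,6491); (49,1690); (51,7750); (55,4677);
      (56,7271); (58,5559); (60,4150); (64,295); (74,5644); (75,7514);
      (80,4025); (81,4099); (83,1973); (90,171); (95,4179); (98,686);
      (99,963); (109,6283); (113,913); (115,7634); (118,6556); (132,3778);
      (136,7748); (154,777); (157,460); (168,314); (181,353); (284,328);
      (340,961); (390,502); (838,897)]);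
 (11%N, 131%N, 73,
  [:: (1,132); (2,504); (3,524); (4,529); (5,256); (6,535); (7,398); (8,56);
      (9,620); (10,122); (11,310); (12,443); (13,415); (14,668); (15,173);
      (16,114); (17,50); (18,186); (19,35); (21,442); (22,274); (23,607);
      (24,499); (25,68); (26,171); (28,252); (29,149); (31,440); (32,421);
      (33,331); (36,205); (37,703); (38,72); (41,46); (42,179); (44,512);
      (47,289); (48,358); (49,240); (52,216); (60,69); (61,266); (62,89);
      (64,291); (65,500); (66,488); (67,613); (71,279); (77,383); (84,491);
      (87,578); (88,661); (93,386); (94,464); (97,425); (101,614); (103,586);
      (105,154); (113,201); (121,221); (123,683); (133,294); (141,307);
      (145,548); (152,385); (155,694); (170,350); (175,450); (204,339);
      (211,506); (261,718); (287,446)]);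
 (131%N, 131%N, 111,
  [:: (1,7471); (2,1726); (3,4531); (4,6613); (5,426); (6,7029); (7,5627);
      (9,5211); (10,7389); (11,4278); (12,3981); (13,3443); (14,5816);
      (15,8229); (16,5663); (17,3336); (18,5127); (19,3564); (23,604);
      (24,6300); (25,1452); (26,7619); (28,7153); (29,1815); (30,4660);
      (32,6391); (34,5361); (36,6796); (37,5467); (38,7329); (40,6424);
      (41,4797); (43,3948); (46,840); (49,734); (52,5487); (53,508);
      (55,3417); (56,1872); (57,1341); (70,2971); (72,691); (73,7151);
      (77,1222); (79,2816); (86,519); (96,451); (97,438); (98,5544);
      (99,4211); (112,668); (135,672); (165,4650); (244,6307); (251,8212);
      (268,712); (272,6708); (311,331); (335,491); (357,951); (455,658);
      (502,1587); (524,882); (540,554); (545,785); (825,975)]);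
 (7%N, 139%N, 236,
  [:: (1,432); (2,486); (3,399); (4,264); (5,390); (6,241); (7,42); (8,434);
      (9,469); (10,76); (11,292); (12,104); (13,419); (14,60); (15,340);
      (16,88); (17,203); (18,311); (19,179); (20,183); (21,366); (22,343);
      (23,30); (24,319); (25,440); (26,204); (27,148); (31,131); (34,47);
      (35,436); (36,324); (38,380); (39,349); (40,50); (41,316); (43,137);
      (45,427); (46,109); (48,176); (49,354); (51,315); (52,416); (53,64);
      (55,325); (56,89); (57,214); (59,431); (61,368); (63,255); (65,344);
      (67,448); (68,452); (69,461); (71,133); (72,391); (73,229); (75,353);
      (78,278); (80,160); (82,222); (84,166); (85,337); (94,361); (96,191);
      (98,113); (101,156); (102,274); (105,307); (106,285); (121,407);
      (122,299); (125,409); (129,168); (130,142); (135,205); (138,415);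
      (147,477); (151,378); (155,258); (208,279); (233,471)]);
 (47%N, 139%N, 10,
  [:: (1,3131); (2,2775); (3,2436); (4,845); (6,33); (7,116); (8,2965);
      (9,2582); (11,984); (12,1216); (14,2829); (15,1688); (17,1436);
      (18,2667); (19,1219); (21,2855); (22,612); (23,2688); (24,2818);
      (25,225); (26,247); (27,254); (28,1892); (31,2948); (34,3143);
      (37,1897); (39,1628); (41,931); (43,1576); (48,1616); (50,96);
      (53,1985); (55,2411); (57,643); (59,454); (62,1686); (63,2885);
      (64,376); (66,278); (68,968); (69,861); (72,566); (73,244); (74,202);
      (77,303); (78,1918); (83,141); (86,2313); (93,136); (94,1449);
      (95,2220); (97,2629); (105,377); (106,428); (107,338); (115,373);
      (118,837); (121,2592); (124,1197); (135,298); (138,2892); (153,2175);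
      (178,361); (184,521); (213,743); (295,395); (341,819); (344,563);
      (363,481); (374,671); (577,758)]);
 (139%N, 139%N, 328,
  [:: (1,4088); (2,3205); (3,5127); (4,3852); (5,6342); (6,1001); (7,8834);
      (8,4792); (10,5225); (11,2278); (12,4885); (15,334); (16,2981);
      (17,2200); (19,3360); (20,118); (21,2835); (23,1537); (24,6087);
      (25,9487); (26,7587); (28,8655); (29,6290); (31,5121); (32,3614);
      (38,9242); (40,343); (41,6639); (42,3015); (43,4548); (44,8802);
      (49,734); (50,6976); (53,1887); (56,1376); (58,1357); (61,5449);
      (64,5294); (65,6042); (69,7910); (71,7333); (73,859); (75,4681);
      (77,1352); (78,4372); (79,769); (82,8172); (83,3189); (86,5126);
      (88,588); (96,898); (109,7365); (110,1196); (119,2761); (121,4480);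
      (130,3138); (131,2843); (147,7275); (155,3643); (158,172); (167,7279);
      (184,1846); (196,1148); (197,8179); (206,245); (212,8439); (219,7729);
      (246,320); (319,545); (730,801)]);
 (7%N, 151%N, 33,
  [:: (1,28); (2,358); (3,19); (4,274); (5,416); (6,57); (7,351); (8,392);
      (9,166); (10,91); (11,237); (12,279); (14,434); (15,212); (16,284);
      (17,25); (18,387); (20,435); (21,104); (22,482); (23,446); (24,404);
      (26,421); (29,94); (30,43); (31,339); (35,250); (36,222); (37,372);
      (38,258); (39,407); (40,220); (41,467); (42,112); (45,113); (46,137);
      (47,412); (48,410); (49,323); (50,304); (52,101); (53,332); (55,348);
      (56,401); (59,515); (60,441); (62,507); (70,106); (71,493); (72,291);
      (74,487); (75,115); (76,246); (77,317); (78,219); (81,208); (82,315);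
      (84,521); (85,458); (86,424); (88,114); (92,502); (93,121); (103,324);
      (105,503); (107,455); (108,213); (110,203); (111,136); (116,457);
      (117,453); (118,504); (119,204); (120,402); (123,311); (138,303);
      (144,335); (149,469); (153,239); (155,347); (177,184); (178,275);
      (182,242); (205,207); (214,377); (247,343); (248,376); (309,341)]);
 (11%N, 151%N, 238,
  [:: (1,798); (2,191); (3,295); (4,261); (5,809); (6,583); (8,82); (9,29);
      (11,104); (12,395); (13,161); (15,572); (16,345); (17,63); (18,560);
      (19,824); (20,368); (22,812); (23,193); (24,421); (25,187); (26,33);
      (27,692); (30,443); (31,702); (32,646); (34,423); (36,235); (37,132);
      (38,141); (39,89); (40,70); (41,754); (43,671); (44,302); (46,589);
      (47,768); (48,402); (51,245); (52,616); (54,587); (57,603); (58,347);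
      (60,571); (61,73); (65,697); (67,311); (69,826); (72,488); (79,221);
      (80,290); (81,568); (83,100); (85,480); (87,730); (93,505); (94,644);
      (97,318); (99,121); (109,555); (110,624); (111,514); (116,236);
      (118,756); (122,701); (124,197); (129,409); (138,617); (144,455);
      (149,829); (150,490); (152,207); (155,682); (169,425); (179,434);
      (190,271); (199,650); (200,745); (201,731); (219,660); (249,735);
      (267,592); (269,520)]);
 (31%N, 151%N, 75,
  [:: (1,1378); (2,1292); (3,1593); (4,72); (5,1232); (6,454); (7,2047);
      (10,185); (11,612); (12,214); (13,518); (14,217); (15,1553); (17,643);
      (18,2229); (19,1474); (20,1884); (22,2037); (25,224); (26,1452);
      (27,1045); (29,350); (31,2176); (33,57); (35,1876); (36,689); (37,1092);
      (41,751); (42,990); (43,101); (44,1359); (45,2066); (49,70); (50,234);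
      (51,940); (52,2095); (53,353); (54,1321); (55,2191); (58,822);
      (61,2077); (66,1578); (68,1707); (71,1516); (77,1274); (82,1956);
      (85,2225); (86,1326); (87,1832); (89,196); (90,299); (91,1528);
      (92,304); (93,1738); (94,641); (95,330); (97,2026); (98,513); (99,608);
      (103,2187); (105,411); (116,922); (121,2036); (127,508); (132,179);
      (161,308); (171,442); (174,737); (209,821); (222,261); (227,495);
      (266,818); (341,862); (346,661); (373,524); (388,800); (529,852);
      (690,860)]);
 (151%N, 151%N, 559,
  [:: (1,3903); (2,3835); (3,10326); (4,4944); (5,8235); (6,10211); (7,6423);
      (8,4896); (9,2180); (10,8975); (11,2195); (12,4057); (13,1645);
      (15,1653); (17,4128); (18,5429); (19,10641); (20,2088); (21,8996);
      (22,11213); (25,3163); (26,2048); (27,1734); (28,5705); (29,238);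
      (30,8606); (32,1651); (33,197); (41,8942); (42,6751); (47,4986);
      (48,6872); (49,5113); (50,870); (54,2857); (59,647); (60,690); (61,836);
      (63,8629); (64,6429); (66,1962); (67,3042); (70,5541); (71,1693);
      (73,4263); (75,6557); (77,520); (80,997); (81,6828); (84,8918);
      (85,759); (87,5517); (91,2597); (96,9448); (106,6999); (113,5691);
      (117,875); (124,474); (126,9521); (128,1040); (131,6639); (143,5608);
      (151,9480); (195,3349); (201,3335); (216,261); (250,6931); (310,7096);
      (347,831); (421,3124); (429,957); (547,975); (629,652); (646,5742);
      (660,787); (733,976)]);
 (7%N, 163%N, 59,
  [:: (1,294); (2,428); (3,224); (4,518); (5,208); (6,332); (7,510); (8,414);
      (9,180); (10,446); (11,344); (12,513); (13,205); (14,321); (15,38);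
      (16,217); (17,108); (19,70); (21,101); (22,529); (23,187); (24,175);
      (25,253); (26,238); (27,127); (28,316); (29,165); (30,79); (31,57);
      (32,80); (33,473); (34,53); (36,339); (37,418); (41,383); (42,160);
      (43,105); (44,225); (45,228); (46,429); (47,247); (48,201); (49,539);
      (52,234); (54,81); (55,497); (61,269); (62,93); (64,396); (65,402);
      (66,379); (67,390); (68,305); (69,430); (73,438); (74,475); (75,140);
      (82,505); (83,380); (84,122); (85,536); (87,100); (89,369); (90,182);
      (91,356); (102,364); (104,360); (106,338); (107,246); (109,409);
      (111,363); (113,241); (121,450); (123,202); (124,184); (126,410);
      (128,186); (130,259); (131,365); (132,284); (142,163); (145,420);
      (146,325); (149,558); (151,467); (161,381); (164,546); (168,478);
      (183,526); (185,300); (188,282); (204,538); (221,358); (244,421);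
      (264,320)]);
 (19%N, 163%N, 78,
  [:: (1,1525); (2,610); (3,229); (4,401); (5,726); (6,648); (7,144);
      (8,1166); (9,111); (10,730); (11,792); (12,487); (14,1079); (15,68);
      (16,945); (17,93); (18,285); (19,212); (20,193); (21,768); (22,622);
      (24,712); (25,946); (26,300); (27,282); (30,1087); (31,209); (32,166);
      (33,371); (34,133); (35,680); (36,1018); (37,979); (40,934); (41,1047);
      (42,471); (44,981); (45,681); (46,1222); (47,249); (48,333); (51,553);
      (52,1497); (53,1247); (54,606); (58,233); (60,825); (64,492); (65,181);
      (69,250); (70,403); (72,1049); (73,1039); (77,381); (82,763); (83,176);
      (85,97); (89,242); (91,106); (92,949); (95,1003); (98,1479); (99,764);
      (100,646); (114,886); (115,889); (121,346); (123,175); (132,708);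
      (134,783); (137,494); (155,640); (184,573); (194,682); (216,552);
      (232,524); (235,738); (251,420); (265,293); (272,933); (273,963);
      (295,402); (297,944); (326,424); (342,802); (416,716)]);
 (163%N, 163%N, 266,
  [:: (1,9233); (2,12893); (3,11789); (4,4706); (5,9225); (6,6071); (7,4073);
      (8,1592); (9,5056); (11,5278); (12,5982); (14,12543); (16,3485);
      (18,9818); (20,1853); (21,8412); (22,11125); (23,4374); (25,2955);
      (27,4748); (31,10441); (32,1271); (33,8346); (35,10249); (36,39);
      (37,9140); (40,9728); (41,11663); (42,980); (43,163); (46,2382);
      (47,1763); (49,4828); (50,3008); (53,2841); (54,3290); (58,7454);
      (61,10770); (63,633); (64,2202); (66,2076); (72,9663); (75,428);
      (76,3966); (77,11998); (81,957); (85,3737); (87,3882); (88,12038);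
      (91,97); (92,3551); (96,1746); (98,853); (99,8837); (102,2593);
      (103,2065); (115,202); (116,3515); (119,3088); (123,6311); (127,2417);
      (132,8204); (136,2549); (139,3822); (144,775); (161,6152); (170,9903);
      (220,611); (239,932); (250,9570); (257,7444); (259,2493); (264,6757);
      (278,8465); (329,589); (351,3984); (358,8309); (381,9929); (417,7289);
      (584,639); (615,897); (693,725)]);
 (167%N, 167%N, 253,
  [:: (1,7797); (2,10662); (3,8640); (4,930); (5,6405); (6,7206); (7,2878);
      (8,8159); (9,784); (10,1829); (11,9451); (12,6845); (13,6993);
      (14,4263); (15,5835); (16,7352); (18,293); (19,3586); (20,10962);
      (21,3252); (22,9546); (23,6143); (24,9830); (26,13423); (27,4731);
      (28,9293); (29,9928); (30,7904); (32,3811); (35,5951); (37,8492);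
      (38,50); (40,8477); (41,5127); (42,8279); (43,746); (44,13846);
      (46,8544); (48,7214); (51,379); (53,2050); (56,9354); (57,5244);
      (60,695); (63,7236); (64,4221); (67,5822); (70,260); (75,439);
      (78,3679); (80,11020); (81,12303); (82,6443); (83,9784); (87,212);
      (88,10351); (91,6430); (92,3047); (96,5849); (98,9321); (100,7644);
      (102,4199); (118,9204); (136,2569); (152,9216); (154,6318); (157,9840);
      (158,562); (182,7641); (185,7525); (197,7611); (200,480); (230,8200);
      (254,4389); (262,4706); (282,8375); (289,3986); (317,544); (334,617);
      (407,8864); (503,871); (577,660); (706,4206); (777,900)]);
 (179%N, 179%N, 532,
  [:: (1,10242); (2,2241); (3,5693); (4,12359); (5,1928); (6,13676); (7,8165);
      (8,64); (9,9092); (13,11113); (14,7739); (15,8414); (18,9175);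
      (19,5860); (20,1012); (25,7602); (26,314); (28,12267); (30,4320);
      (31,1288); (33,11616); (35,4583); (36,1731); (37,9004); (39,4830);
      (45,5110); (46,2163); (47,9940); (49,13899); (52,3650); (53,7469);
      (55,8634); (56,10918); (57,1361); (58,155); (61,4307); (62,7379);
      (65,8721); (66,2976); (69,5868); (70,14273); (75,5673); (76,563);
      (77,293); (78,246); (80,122); (83,4698); (85,5953); (90,7152);
      (91,5556); (93,3858); (94,3536); (95,811); (99,10929); (101,3008);
      (105,1122); (109,8384); (113,7115); (124,4515); (126,8031); (127,977);
      (143,320); (147,2792); (149,7140); (159,9502); (171,8556); (172,4570);
      (179,495); (180,401); (182,3686); (185,914); (195,4449); (198,761);
      (219,1272); (225,4045); (237,7785); (266,7009); (275,2117); (287,598);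
      (289,12619); (295,4861); (343,1633); (452,9646); (473,774); (589,820);
      (664,6487); (718,814); (739,967); (757,7956); (770,777)]);
 (11%N, 191%N, 7,
  [:: (1,13); (2,873); (3,620); (4,389); (5,844); (6,242); (8,480); (9,1040);
      (10,224); (11,445); (12,809); (15,692); (16,140); (17,65); (18,114);
      (19,955); (22,1025); (23,454); (24,1045); (25,683); (26,583); (27,855);
      (29,505); (30,225); (31,751); (33,527); (34,235); (36,805); (38,414);
      (39,726); (40,78); (41,281); (44,277); (45,556); (46,808); (47,470);
      (48,709); (50,618); (51,684); (52,434); (53,804); (54,442); (58,703);
      (59,169); (60,765); (61,917); (64,232); (66,838); (67,1039); (68,332);
      (71,874); (72,585); (73,465); (74,1042); (76,669); (79,209); (80,412);
      (82,198); (83,732); (85,837); (88,635); (89,163); (90,565); (93,864);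
      (94,200); (95,373); (96,284); (97,852); (99,1000); (101,463); (102,840);
      (103,953); (106,696); (108,926); (109,206); (118,390); (122,229);
      (132,270); (136,508); (137,971); (142,219); (144,419); (145,787);
      (146,363); (148,535); (150,972); (156,617); (157,743); (158,221);
      (160,436); (176,780); (177,846); (180,391); (183,408); (186,528);
      (187,464); (193,734); (195,433); (204,737); (205,348); (265,452);
      (353,461); (369,712); (376,657); (401,492)]);
 (191%N, 191%N, 176,
  [:: (1,1486); (2,12283); (3,5912); (4,2381); (5,14064); (6,357); (7,2188);
      (8,12203); (9,14114); (11,689); (12,11460); (13,15363); (15,9101);
      (17,954); (18,5441); (19,15020); (20,3341); (22,15090); (23,17748);
      (26,3657); (27,4033); (29,4261); (30,9602); (33,13277); (37,2778);
      (40,1378); (42,7952); (43,6647); (45,9144); (46,5213); (47,539);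
      (50,10478); (52,7196); (53,7794); (54,8351); (58,6816); (60,2194);
      (63,5113); (64,2115); (69,4988); (71,3691); (74,695); (76,3127);
      (77,1776); (78,6280); (79,15809); (81,8936); (85,8672); (86,517);
      (89,8859); (90,13360); (91,7479); (94,9523); (95,8875); (98,458);
      (103,2250); (109,7802); (116,2678); (117,3380); (122,8493); (123,8785);
      (134,302); (148,885); (150,5072); (151,2854); (161,3246); (163,4968);
      (167,8178); (201,8328); (215,788); (216,8413); (218,865); (238,6898);
      (241,6471); (244,776); (247,1884); (262,4427); (270,8986); (287,548);
      (293,1745); (296,2177); (304,5612); (314,417); (319,660); (326,890);
      (334,9234); (368,8141); (388,9572); (400,731); (435,5994); (490,594);
      (504,753); (578,772); (607,900); (645,9736); (811,909)]);
 (7%N, 199%N, 306,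
  [:: (1,494); (2,142); (3,568); (4,615); (5,131); (6,500); (7,268); (8,266);
      (9,83); (10,471); (11,26); (12,17); (13,183); (15,548); (16,218);
      (18,271); (19,400); (21,368); (22,232); (23,87); (24,406); (25,327);
      (27,566); (28,648); (29,662); (30,216); (31,282); (33,272); (34,91);
      (35,297); (36,467); (37,92); (38,477); (39,596); (42,435); (43,363);
      (44,491); (45,564); (46,693); (47,691); (48,457); (49,53); (52,430);
      (54,456); (55,624); (56,343); (57,423); (58,547); (60,129); (61,170);
      (62,559); (63,659); (65,576); (66,493); (67,432); (69,386); (70,527);
      (71,152); (72,509); (76,658); (77,116); (78,465); (80,167); (81,90);
      (84,215); (86,639); (88,248); (89,211); (93,353); (94,257); (97,318);
      (99,174); (101,304); (106,195); (108,558); (110,206); (112,604);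
      (113,503); (115,632); (117,664); (120,512); (121,335); (122,450);
      (124,556); (126,438); (130,295); (133,213); (134,238); (139,524);
      (153,436); (157,188); (158,172); (161,390); (163,684); (165,643);
      (171,588); (175,359); (180,513); (181,518); (186,472); (189,245);
      (199,490); (203,529); (212,395); (217,652); (221,595); (239,563);
      (240,517); (249,299); (253,417); (254,609); (258,495); (263,586);
      (267,522); (280,380); (358,627)]);
 (19%N, 199%N, 21,
  [:: (1,918); (2,318); (3,270); (4,304); (5,1791); (6,332); (7,601);
      (8,1018); (9,1358); (10,860); (11,223); (12,1232); (13,924); (14,839);
      (15,1049); (16,65); (18,321); (22,340); (23,963); (27,448); (28,537);
      (30,510); (31,82); (32,1196); (33,154); (34,969); (35,1551); (36,1579);
      (38,634); (40,623); (41,1708); (45,1815); (46,365); (47,75); (48,354);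
      (49,881); (52,1060); (53,1374); (54,1844); (56,738); (57,1860);
      (58,865); (61,817); (62,1862); (64,393); (68,1276); (70,546); (72,1668);
      (73,325); (74,1419); (78,1496); (79,338); (80,211); (81,1594);
      (83,1271); (86,132); (88,802); (89,150); (90,680); (91,1091); (92,290);
      (93,1322); (96,978); (97,976); (99,262); (101,161); (102,447);
      (104,607); (111,468); (112,1573); (115,886); (117,442); (127,133);
      (136,1350); (141,800); (143,620); (153,333); (160,497); (162,438);
      (171,971); (173,293); (186,837); (192,380); (205,707); (212,941);
      (233,638); (245,792); (261,439); (272,429); (278,649); (279,535);
      (281,811); (288,1331); (313,855); (319,577); (460,934); (466,559);
      (471,512); (477,907); (498,949); (551,970); (562,663); (576,1695);
      (662,739); (744,972)]);
 (23%N, 199%N, 11,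
  [:: (1,528); (2,487); (3,1721); (4,2250); (5,826); (6,1984); (7,390);
      (8,898); (9,2110); (12,1042); (13,486); (14,1468); (15,1356); (16,2226);
      (17,1299); (18,1646); (19,1229); (20,2282); (23,1949); (25,137);
      (26,1563); (28,146); (29,93); (30,412); (32,1864); (34,1980); (36,1758);
      (37,1126); (40,1975); (41,208); (42,1375); (43,789); (46,594);
      (47,1892); (49,958); (50,424); (51,531); (52,945); (53,1560); (56,670);
      (57,2046); (58,332); (59,2224); (60,1650); (61,1597); (62,541);
      (63,507); (64,731); (65,1569); (67,2155); (69,2281); (72,1196);
      (73,1063); (74,1164); (78,480); (79,970); (83,2095); (84,723);
      (85,1566); (92,906); (94,1044); (95,387); (96,1756); (97,1359);
      (102,708); (106,521); (109,571); (111,522); (115,1754); (116,942);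
      (119,899); (128,1918); (129,255); (130,857); (133,816); (138,879);
      (144,999); (159,555); (167,813); (170,677); (174,952); (179,314);
      (194,851); (199,862); (213,762); (214,479); (235,430); (247,609);
      (301,596); (309,1842); (318,634); (331,777); (334,362); (335,955);
      (344,624); (355,785); (359,911); (360,603); (375,950); (439,666);
      (464,535); (476,782); (501,771); (656,912)]);
 (67%N, 199%N, 12,
  [:: (1,6583); (2,6634); (3,893); (4,2745); (5,6300); (6,2823); (7,4106);
      (8,4596); (11,1978); (13,851); (14,209); (15,2781); (16,5737);
      (18,6389); (19,3534); (20,3902); (21,3303); (22,1612); (25,2446);
      (26,4306); (27,4348); (28,6360); (29,2916); (30,4766); (31,3208);
      (33,6139); (35,6592); (37,6521); (40,1164); (42,5593); (44,1158);
      (45,852); (50,2801); (55,1939); (56,120); (57,671); (58,5277); (61,871);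
      (62,6580); (63,4142); (64,5869); (65,5638); (67,511); (70,1034);
      (73,4724); (74,1641); (75,2003); (78,140); (80,5583); (88,1434);
      (90,5466); (91,1028); (94,5358); (95,3930); (98,1803); (100,6086);
      (101,4942); (105,1671); (107,5853); (116,3894); (122,4008); (125,3781);
      (133,5733); (137,2620); (139,2325); (142,5166); (146,154); (148,3286);
      (149,2165); (151,2468); (157,1757); (160,1977); (179,3120); (181,4497);
      (183,4204); (189,4795); (194,791); (211,1927); (222,4498); (224,3296);
      (232,2366); (242,402); (244,6509); (275,2858); (279,891); (291,674);
      (313,873); (320,819); (343,930); (359,3038); (385,6593); (405,583);
      (424,987); (428,3285); (582,668); (623,735); (627,801); (628,667);
      (800,951); (818,931); (913,989)]);
 (199%N, 199%N, 1312,
  [:: (1,14974); (2,9974); (3,17911); (4,16266); (6,10880); (8,11177);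
      (9,979); (11,14176); (14,6730); (15,16140); (18,15607); (19,12789);
      (22,4763); (27,908); (28,867); (29,9726); (30,9014); (31,15834);
      (33,4965); (35,18517); (36,19276); (37,19303); (39,12395); (40,14798);
      (41,13984); (42,5627); (44,1101); (45,9988); (47,6889); (48,5222);
      (50,14451); (54,659); (57,12265); (58,10466); (59,7916); (60,18213);
      (62,15188); (64,3477); (65,5471); (66,11490); (70,10860); (71,9090);
      (72,4944); (76,6602); (77,9218); (78,19466); (82,1547); (83,8907);
      (85,3207); (86,747); (87,13266); (89,780); (90,5419); (92,5518);
      (95,8114); (97,5710); (98,2760); (99,7121); (100,7334); (101,815);
      (109,5630); (125,6486); (129,4246); (135,3879); (147,9991); (150,809);
      (156,2844); (167,5395); (179,9997); (205,217); (206,480); (213,783);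
      (216,6252); (233,1604); (247,6354); (256,3977); (266,2976); (273,9515);
      (278,8584); (282,5642); (283,5040); (284,4510); (303,7885); (305,730);
      (320,328); (331,1744); (364,5441); (366,3586); (375,8954); (384,5438);
      (388,2857); (397,9802); (428,7852); (458,901); (559,928); (624,3838);
      (638,3819); (655,767); (741,3122); (744,802)])]%num.

Lemma certificates_valid : all certifies certificates.
Proof. by vm_compute. Qed.

(** * Completeness of the list and conclusion *)

Definition admissible_primes : seq nat :=
  [seq q <- iota 4 196 | (q %% 4 == 3)%N && prime q].

Lemma certificates_complete :
  all (fun q => all (fun p => (p - 1 %| q - 1)%N ==>
                       ((p, q) \in [seq C.1.1 | C <- certificates]))
                    admissible_primes)
      admissible_primes.
Proof. by vm_compute. Qed.

Local Open Scope nat_scope.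

Theorem theorem5p4 (p q : nat)
  (hq : prime q) (hq4 : q = 3 %[mod 4]) (hq3 : 3 < q) (hq200 : q < 200)
  (hp : prime p) (hp4 : p = 3 %[mod 4]) (hp3 : 3 < p)
  (hpq : (p - 1) %| (q - 1)) :
  (exists S : {set {set 'Z_(p * q)}}, partitionable_set S) /\
  (exists R : 'I_(p * q) -> round 'Z_(p * q), ZCPS_whist R).
Proof.
(* As q - 1 is positive, divisibility bounds p - 1 by q - 1. Hence p is also below 200 and occurs in
   the same finite enumeration as q. *)
have le_pq : p <= q.
  by have := dvdn_leq _ hpq; rewrite subn_gt0 => /(_ (prime_gt1 hq)); lia.
have pQ : p \in admissible_primes.
  by rewrite mem_filter hp4 hp mem_iota hp3 (leq_ltn_trans le_pq).
have qQ : q \in admissible_primes.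
  by rewrite mem_filter hq4 hq mem_iota hq3.
have := allP (allP certificates_complete q qQ) p pQ; rewrite hpq.
case/mapP=> -[[[p' q'] g] ps] C_in [? ?]; subst p' q'.
apply: certifies_sound (allP certificates_valid _ C_in).
by move: hp3 hq3; nia.
Qed.
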